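(* For any $(d_1,d_2)\in\mathbb Z^2$ and any $(p,q)\in\mathbb N^2$, \[ c(p,q)=\sum_{\omega}\mathrm{wt}(\omega), \] the sum over all compatible gradings $\omega$ on $\mathcal P([d_1]_+,[d_2]_+)$ with $\omega(\mathcal P_{\mathbf N})=p$ and $\omega(\mathcal P_{\mathbf E})=q$. Equivalently, $x[d_1,d_2]=x_1^{-d_1}x_2^{-d_2}\sum_\omega\mathrm{wt}(\omega)x_1^{\omega(\mathcal P_{\mathbf N})}x_2^{\omega(\mathcal P_{\mathbf E})}$, the sum over all compatible gradings on $\mathcal P([d_1]_+,[d_2]_+)$.
   Context: For $i=1,2$ let $p_{i,\bullet}=(p_{i,k})_{k=1}^{\ell_i}$, $\ell_i\in\mathbb Z_{\ge1}\cup\{\infty\}$, be independent variables; set $p_{i,0}=1$ and $p_{i,k}=0$ for $k>\ell_i$. For a sequence $p_\bullet=(p_k)_{k\ge1}$ and $m\ge0$ define polynomials $\pi_{m,n}(p_\bullet)$, $\varsigma_{m,n}(p_\bullet)$ by $(1+\sum_{k\ge1}p_kz^k)^m=\sum_{n\ge0}\pi_{m,n}(p_\bullet)z^n$ and $(1+\sum_{k\ge1}p_kz^k)^{-m}=\sum_{n\ge0}\varsigma_{m,n}(p_\bullet)z^n$, with the conventions $\pi_{m,0}=\varsigma_{m,0}=1$ for all $m\in\mathbb Z$ and $\pi_{m,n}=\varsigma_{m,n}=0$ for $m<0$, $n\ne0$. For integer polynomials $f,g$ in the variables $p_{i,k}$, $\operatorname{T\text{-}max}(f,g)=\sum_e\max([p^e]f,[p^e]g)\,p^e$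 (coefficientwise maximum over monomials $p^e$). Fix $(d_1,d_2)\in\mathbb Z^2$ and define $c(p,q)$ for $(p,q)\in\mathbb N^2$ recursively by $c(0,0)=1$ and $c(p,q)=\operatorname{T\text{-}max}\Bigl(\sum_{k=1}^p-c(p-k,q)\varsigma_{d_2-q,k}(p_{1,\bullet}),\ \sum_{k=1}^q-c(p,q-k)\varsigma_{d_1-p,k}(p_{2,\bullet})\Bigr).$ The greedy element is $x[d_1,d_2]=x_1^{-d_1}x_2^{-d_2}\sum_{(p,q)\in\mathbb N^2}c(p,q)x_1^px_2^q$. Here $[d]_+=\max(d,0)$. Dyck paths and gradings: for $d_1,d_2\ge0$, $\mathcal P(d_1,d_2)$ is the highest lattice path of unit east (horizontal) and north (vertical) edges from $(0,0)$ to $(d_1,d_2)$ never passing strictly above the segment joining them; horizontal edges $u_1,\dots,u_{d_1}$ left to right, vertical edges $v_1,\dots,v_{d_2}$ bottom to top; $\mathcal P_{\mathbf E},\mathcal P_{\mathbf N}$ the horizontal/vertical edge sets; for a set $C$ of edges $C_{\mathbf E},C_{\mathbf N}$ and $|C|$ as usual; $\overrightarrow{ef}$ is the set of edges from $e$ to $f$ along the path inclusive, continuing cyclically from the last edge to the first if $f$ comes before $e$. A grading is a map $\omega$ from edges to $\mathbb N$, $\omega(C)=\sum_{e\in C}\omega(e)$. It is compatible if for all $u\in\mathcal P_{\mathbf E}$, $v\in\mathcal P_{\mathbf N}$ with $\omega(u)\omega(v)>0$ some $e\in\overrightarrow{uv}$ satisfies either $e\in\mathcal P_{\mathbf N}\setminus\{v\}$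 and $|(\overrightarrow{ue})_{\mathbf N}|=\omega((\overrightarrow{ue})_{\mathbf E})$, or $e\in\mathcal P_{\mathbf E}\setminus\{u\}$ and $|(\overrightarrow{ev})_{\mathbf E}|=\omega((\overrightarrow{ev})_{\mathbf N})$. Weight: $\mathrm{wt}(\omega)=\prod_{i=1}^{d_1}p_{2,\omega(u_i)}\prod_{j=1}^{d_2}p_{1,\omega(v_j)}$. *)

(* Defs.v *)
From HB Require Import structures.
From mathcomp Require Import all_boot all_order all_algebra.
From mathcomp Require Import finmap.
From mathcomp.multinomials Require Import monalg.

Set Implicit Arguments.
Unset Strict Implicit.
Unset Printing Implicit Defensive.

Import Order.TTheory GRing.Theory Num.Theory.
Local Open Scope ring_scope.

(* Integer polynomials in the commuting variables X_(i,k), (i,k) : nat * nat.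
   Only the variables (1,k), (2,k) with k >= 1 are used: X_(i,k) = p_{i,k}. *)
Definition Pol := {malg int[{cmonom (nat * nat)%type}]}.

Definition Xv (i k : nat) : Pol := << ucm (i, k) >>.

(* l : option nat encodes l_i in Z_{>=1} \cup {oo}: Some n = n, None = oo. *)
Definition in_range (l : option nat) (k : nat) : bool :=
  if l is Some n then (k <= n)%N else true.

Definition pv (l : option nat) (i k : nat) : Pol :=
  if k == 0%N then 1 else if in_range l k then Xv i k else 0.

(* Coefficients s_0, ..., s_n of the power series (1 + sum_{k>=1} a_k z^k)^(-1):
   s_0 = 1, s_n = - sum_{k=1}^n a_k s_{n-k}. *)
Fixpoint inv_coefs (a : nat -> Pol) (n : nat) : seq Pol :=
  match n with
  | 0 => [:: 1]
  | n'.+1 => let s := inv_coefs a n' in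
             rcons s (- \sum_(k < n'.+1) a k.+1 * nth 0 s (n' - k)%N)
  end.

(* varsigma_{m,n}(a): coefficient of z^n in (1 + sum_{k>=1} a_k z^k)^(-m),
   for m >= 0 (computed in the power series ring, truncated at order n);
   conventions: varsigma_{m,0} = 1 and varsigma_{m,n} = 0 for m < 0, n <> 0. *)
Definition vsig (m : int) (n : nat) (a : nat -> Pol) : Pol :=
  match m with
  | Posz m' => ((Poly (inv_coefs a n)) ^+ m')`_n
  | Negz _ => (n == 0%N)%:R
  end.

Definition tmax (f g : Pol) : Pol :=
  [malg m in (msupp f `|` msupp g)%fset => Num.max f@_m g@_m].

(* The recursion defining c(p,q); fuel >= p + q makes it the intended one. *)
Fixpoint cgen (l1 l2 : option nat) (d1 d2 : int) (fuel p q : nat) : Pol :=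
  if (p == 0%N) && (q == 0%N) then 1 else
  match fuel with
  | 0 => 0
  | f.+1 =>
      tmax (\sum_(1 <= k < p.+1) - cgen l1 l2 d1 d2 f (p - k) q
                                   * vsig (d2 - q%:Z) k (pv l1 1))
           (\sum_(1 <= k < q.+1) - cgen l1 l2 d1 d2 f p (q - k)
                                   * vsig (d1 - p%:Z) k (pv l2 2))
  end.

Definition cc (l1 l2 : option nat) (d1 d2 : int) (p q : nat) : Pol :=
  cgen l1 l2 d1 d2 (p + q) p q.

Definition posp (d : int) : nat := if d is Posz n then n else 0%N.

(* The highest lattice path from (0,0) to (a,b) weakly below the segment:
   step list, true = east (horizontal), false = north (vertical).
   From (x,y), go north iff (x,y+1) is weakly below the line, i.e. (y+1)a <= bx. *)
Fixpoint steps (a b fuel x y : nat) : seq bool :=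
  match fuel with
  | 0 => [::]
  | f.+1 => if ((y.+1 * a) <= b * x)%N then false :: steps a b f x y.+1
            else true :: steps a b f x.+1 y
  end.

Definition dpath (a b : nat) : seq bool := steps a b (a + b) 0 0.

(* Edges are indexed by their position 0 .. a+b-1 along the path. *)
Definition isE (a b k : nat) : bool := nth false (dpath a b) k.

Definition in_arc (i j k : nat) : bool :=
  if (i <= j)%N then (i <= k <= j)%N else ((i <= k)%N || (k <= j)%N).

Definition compatible (a b : nat) (w : 'I_(a + b) -> nat) : bool :=
  [forall u : 'I_(a + b), forall v : 'I_(a + b),
    (isE a b u && ~~ isE a b v && (0 < w u * w v)%N) ==>
    [exists e : 'I_(a + b), in_arc u v e &&
      ((~~ isE a b e && (e != v) &&
         (#|[set k : 'I_(a + b) | in_arc u e k && ~~ isE a b k]| ==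
          \sum_(k : 'I_(a + b) | in_arc u e k && isE a b k) w k)%N)
    || (isE a b e && (e != u) &&
         (#|[set k : 'I_(a + b) | in_arc e v k && isE a b k]| ==
          \sum_(k : 'I_(a + b) | in_arc e v k && ~~ isE a b k) w k)%N))]].

Definition wN (a b : nat) (w : 'I_(a + b) -> nat) : nat :=
  (\sum_(k : 'I_(a + b) | ~~ isE a b k) w k)%N.
Definition wE (a b : nat) (w : 'I_(a + b) -> nat) : nat :=
  (\sum_(k : 'I_(a + b) | isE a b k) w k)%N.

Definition wt (l1 l2 : option nat) (a b : nat) (w : 'I_(a + b) -> nat) : Pol :=
  \prod_(k : 'I_(a + b)) (if isE a b k then pv l2 2 (w k) else pv l1 1 (w k)).

(* Main.v *)
(* Fix the horizontal part of a grading, of total weight q < d2. The horizontal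
   edges of positive weight cast a shadow on the vertical edges; exactly d2 - q
   vertical edges stay outside it (cycle lemma), compatibility puts no condition
   on them, and it does not involve their weights. Hence for fixed q the
   generating function in p of the compatible gradings is R_q * P_1^(d2 - q),
   with R_q counting those supported on the shadow, and dividing by
   P_1^(d2 - q) shows that the first sum of the recursion equals the expected
   value minus the coefficient of R_q. Reflecting the path gives the same for
   the second sum. Both corrections are nonnegative, so the maximum is as
   expected once one of them vanishes: if E casts a shadow containing the
   support on N, cutting that shadow into first-return arcs and comparing each
   with the slope of the diagonal gives p * d2 < q * d1, and the other correction
   requires the reverse inequality. *)

Require Import Defs.
From HB Require Import structures.
From mathcomp Require Import all_boot all_order all_algebra.
From mathcomp Require Import finmap zify.
From mathcomp.multinomials Require Import monalg.

Set Implicit Arguments.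
Unset Strict Implicit.
Unset Printing Implicit Defensive.

Import Order.TTheory GRing.Theory Num.Theory.
Local Open Scope ring_scope.

(** * The unrolled path *)

Section PartialSums.
Variable n : nat.
Notation N := n.+1.

(* The path is unrolled periodically: position i stands for the edge i mod N. *)
Definition psum (f : 'I_N -> int) (k : nat) : int :=
  \sum_(0 <= i < k) f (inZp i).

Lemma psum0 f : psum f 0 = 0.
Proof. by rewrite /psum big_geq. Qed.

Lemma psumS f k : psum f k.+1 = psum f k + f (inZp k).
Proof. by rewrite /psum big_nat_recr. Qed.

Lemma inZp_addn k : inZp (k + N) = inZp k :> 'I_N.
Proof. by apply: val_inj; rewrite /= modnDr. Qed.

Lemma psum_period f k : psum f (k + N) = psum f k + \sum_i f i.
Proof.
elim: k => [|k IH].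
  rewrite psum0 add0n add0r /psum big_mkord; apply: eq_bigr => i _.
  by rewrite valZpK.
by rewrite addSn !psumS IH inZp_addn addrAC.
Qed.

Lemma psum_total f : psum f N = \sum_i f i.
Proof. by have := psum_period f 0; rewrite psum0 !add0r. Qed.

Lemma inZp_shift a r : inZp (a * N + r) = inZp r :> 'I_N.
Proof. by apply: val_inj; rewrite /= modnMDl. Qed.

Lemma inZp_decomp U d : (d < N)%N -> exists a u, [/\ U = (a * N + u)%N, (u < N)%N,
  (inZp U : 'I_N) = u :> nat &
  (inZp (U + d) : 'I_N) = (if u + d < N then u + d else u + d - N)%N :> nat ].
Proof.
move=> ltd; exists (U %/ N)%N, (U %% N)%N.
have ltu : (U %% N < N)%N by rewrite ltn_mod.
split=> //; first by rewrite -divn_eq.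
rewrite /= {1}(divn_eq U N) -addnA modnMDl.
case: ifP => h; first by rewrite modn_small.
rewrite -{1}(subnK (_ : N <= U %% N + d)%N) ?modnDr; last by rewrite leqNgt h.
by rewrite modn_small; lia.
Qed.

(** Within one period starting at [U] a cyclic arc is an ordinary interval, which removes
    wrap-around from the arguments about walks. *)
Lemma in_arc_inZp U V E : (U <= V < U + N)%N -> (U <= E < U + N)%N ->
  in_arc (inZp U : 'I_N) (inZp V : 'I_N) (inZp E : 'I_N) = (E <= V)%N.
Proof.
move=> hV hE.
have [|a [u [eU ltu eu]]] := @inZp_decomp U (V - U); first lia.
have [|a' [u' [eU' ltu' eu']]] := @inZp_decomp U (E - U); first lia.
rewrite !subnKC; try lia.
move=> -> ->; rewrite eu /in_arc.
have -> : u' = u by rewrite -eu -eu'.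
by do ![case: ifP]; lia.
Qed.

Lemma inZp_inj_window U V E : (U <= V < U + N)%N -> (U <= E < U + N)%N ->
  inZp V = inZp E :> 'I_N -> V = E.
Proof.
move=> hV hE e.
have := in_arc_inZp hV hE; rewrite -e (in_arc_inZp hV hV) leqnn => /esym.
have := in_arc_inZp hE hV; rewrite e (in_arc_inZp hE hE) leqnn => /esym.
lia.
Qed.

Lemma inZp_lift U (v : 'I_N) : exists V, (U <= V < U + N)%N /\ inZp V = v.
Proof.
have [|a [x [eU ltu eu _]]] := @inZp_decomp U 0; first lia.
have ltv := ltn_ord v.
exists (if x <= v then a * N + v else a.+1 * N + v)%N; split.
  by case: ifP; lia.
by case: ifP => _; rewrite inZp_shift valZpK.
Qed.

Lemma psum_arc (f : 'I_N -> int) U V : (U <= V < U + N)%N ->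
  \sum_(k : 'I_N | in_arc (inZp U : 'I_N) (inZp V : 'I_N) k) f k
  = psum f V.+1 - psum f U.
Proof.
move=> hUV; rewrite -(subnKC (n := V) (m := U)); last lia.
have : (V - U < N)%N by lia.
elim: (V - U)%N => {V hUV} [_|d IH lt_d].
  rewrite addn0 psumS addrAC subrr add0r (big_pred1 (inZp U)) // => k.
  have [E [hE <-]] := inZp_lift U k.
  rewrite in_arc_inZp /=; try lia.
  apply/idP/eqP => [h|/(@inZp_inj_window U)]; first by congr inZp; lia.
  by move=> h; rewrite h; lia.
rewrite addnS psumS addrAC -IH; last lia.
rewrite (bigD1 (inZp (U + d).+1)) /=; last first.
  by rewrite in_arc_inZp; lia.
rewrite addrC; congr (_ + _); apply: eq_bigl => k.
have [E [hE <-]] := inZp_lift U k.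
rewrite !in_arc_inZp; try lia.
case: eqP => [/(@inZp_inj_window U) h|ne]; first by rewrite h; lia.
have : E <> (U + d).+1 by move=> h; apply: ne; rewrite h.
lia.
Qed.

End PartialSums.

(** * Compatibility and shadows *)

Section Grading.
Variables (n : nat) (t : 'I_n -> bool) (w : 'I_n -> nat).

(* The walk with steps stepE (resp. stepN) returns to its level over an arc
   exactly when the first (resp. second) equality of compatibility holds. *)
Definition stepE (k : 'I_n) : int := if t k then (w k)%:Z else -1.
Definition stepN (k : 'I_n) : int := if t k then -1 else (w k)%:Z.

(* v lies outside the shadow cast by u on the vertical edges. *)
Definition ends_before (u v : 'I_n) : bool :=
  [exists e : 'I_n, in_arc u v e && (~~ t e && (e != v) &&
     (#|[set k : 'I_n | in_arc u e k && ~~ t k]| ==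
      \sum_(k : 'I_n | in_arc u e k && t k) w k)%N)].

(* u lies outside the shadow cast by v on the horizontal edges. *)
Definition starts_after (u v : 'I_n) : bool :=
  [exists e : 'I_n, in_arc u v e && (t e && (e != u) &&
     (#|[set k : 'I_n | in_arc e v k && t k]| ==
      \sum_(k : 'I_n | in_arc e v k && ~~ t k) w k)%N)].

Definition gcompat : bool :=
  [forall u : 'I_n, forall v : 'I_n, (t u && ~~ t v && (0 < w u * w v)%N) ==>
    (ends_before u v || starts_after u v)].

Definition sumN : nat := (\sum_(k : 'I_n | ~~ t k) w k)%N.
Definition sumE : nat := (\sum_(k : 'I_n | t k) w k)%N.

Definition unshadowed (v : 'I_n) : bool :=
  ~~ t v && [forall u : 'I_n, (t u && (0 < w u)%N) ==> ends_before u v].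

Lemma sum_stepE (P : pred 'I_n) : \sum_(k | P k) stepE k =
  (\sum_(k | P k && t k) w k)%N%:Z - #|[set k | P k && ~~ t k]|%:Z.
Proof.
rewrite (bigID t) /=; congr (_ + _).
  rewrite (big_morph _ PoszD (erefl _)); apply: eq_bigr => k /andP[_ tk].
  by rewrite /stepE tk.
rewrite cardsE -sum1_card (big_morph _ PoszD (erefl _)) -sumrN.
by apply: eq_big => k; rewrite ?inE // => /andP[_ /negbTE tk]; rewrite /stepE tk.
Qed.

Lemma sum_stepN (P : pred 'I_n) : \sum_(k | P k) stepN k =
  (\sum_(k | P k && ~~ t k) w k)%N%:Z - #|[set k | P k && t k]|%:Z.
Proof.
rewrite (bigID t) /= addrC; congr (_ + _).
  rewrite (big_morph _ PoszD (erefl _)); apply: eq_bigr => k /andP[_ /negbTE tk].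
  by rewrite /stepN tk.
rewrite cardsE -sum1_card (big_morph _ PoszD (erefl _)) -sumrN.
by apply: eq_big => k; rewrite ?inE // => /andP[_ tk]; rewrite /stepN tk.
Qed.

Lemma total_stepE : \sum_k stepE k = sumE%:Z - #|[set k | ~~ t k]|%:Z.
Proof. by rewrite (sum_stepE predT). Qed.

Lemma total_stepN : \sum_k stepN k = sumN%:Z - #|[set k | t k]|%:Z.
Proof. by rewrite (sum_stepN predT). Qed.

End Grading.

Section Unrolled.
Variables (n : nat).
Notation N := n.+1.
Variables (t : 'I_N -> bool) (w : 'I_N -> nat).
Notation tt k := (t (inZp k)).
Notation ww k := (w (inZp k)).
Notation S := (psum (stepE t w)).
Notation H := (psum (stepN t w)).

Lemma ends_beforeP U V : (U <= V < U + N)%N ->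
  ends_before t w (inZp U) (inZp V) <->
  exists E, [/\ (U <= E < V)%N, ~~ tt E & S E.+1 = S U].
Proof.
move=> hUV; split=> [/existsP[e]|[E [hE tE eS]]].
  have [E [hE <-]] := inZp_lift U e.
  rewrite in_arc_inZp // => /and3P[leEV /andP[tE neV] /eqP eqc].
  exists E; split=> //.
    rewrite ltn_neqAle leEV andbT; case/andP: hE => -> _ /=.
    by apply: contraNneq neV => ->.
  by apply/eqP; rewrite -subr_eq0 -psum_arc // sum_stepE eqc subrr.
apply/existsP; exists (inZp E); rewrite in_arc_inZp ?tE //; last lia.
have -> /= : (E <= V)%N by lia.
apply/andP; split.
  apply/eqP => /(@inZp_inj_window _ U) h; lia.
rewrite eq_sym -eqz_nat -subr_eq0 -sum_stepE.
by rewrite psum_arc ?eS ?subrr //; lia.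
Qed.

Lemma starts_afterP U V : (U <= V < U + N)%N ->
  starts_after t w (inZp U) (inZp V) <->
  exists E, [/\ (U < E <= V)%N, tt E & H V.+1 = H E].
Proof.
move=> hUV; split=> [/existsP[e]|[E [hE tE eS]]].
  have [E [hE <-]] := inZp_lift U e.
  rewrite in_arc_inZp // => /and3P[leEV /andP[tE neV] /eqP eqc].
  exists E; split=> //.
    rewrite leEV andbT ltn_neqAle eq_sym; case/andP: hE => -> _ /=.
    by rewrite andbT; apply: contraNneq neV => ->.
  apply/eqP; rewrite -subr_eq0 -psum_arc; last lia.
  by rewrite sum_stepN eqc subrr.
apply/existsP; exists (inZp E); rewrite in_arc_inZp ?tE //; last lia.
have -> /= : (E <= V)%N by lia.
apply/andP; split.
  apply/eqP => /(@inZp_inj_window _ U) h; lia.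
rewrite eq_sym -eqz_nat -subr_eq0 -sum_stepN.
by rewrite psum_arc ?eS ?subrr //; lia.
Qed.

Lemma gcompatP : gcompat t w <-> forall U V, (U <= V < U + N)%N ->
  tt U -> ~~ tt V -> (0 < ww U)%N -> (0 < ww V)%N ->
  (exists E, [/\ (U <= E < V)%N, ~~ tt E & S E.+1 = S U]) \/
  (exists E, [/\ (U < E <= V)%N, tt E & H V.+1 = H E]).
Proof.
split=> [/forallP cw U V hUV tU tV wU wV|cw].
  have /forallP/(_ (inZp V)) := cw (inZp U).
  rewrite tU tV muln_gt0 wU wV /= => /orP[/ends_beforeP|/starts_afterP] h.
    by left; apply: h.
  by right; apply: h.
apply/forallP => u; apply/forallP => v; apply/implyP.
rewrite -(valZpK u); have [V [hV <-]] := inZp_lift u v.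
rewrite muln_gt0 => /andP[/andP[tU tV] /andP[wU wV]].
case: (cw u V) => // h; apply/orP.
  by left; apply/ends_beforeP.
by right; apply/starts_afterP.
Qed.

(** [n <= V] leaves room for a full period of positions ending at [V], so every edge has a
    representative there. *)
Lemma unshadowedP V : (n <= V)%N -> unshadowed t w (inZp V) <->
  ~~ tt V /\ forall U, (U <= V < U + N)%N -> tt U -> (0 < ww U)%N ->
     exists E, [/\ (U <= E < V)%N, ~~ tt E & S E.+1 = S U].
Proof.
move=> leNV; split=> [/andP[tV /forallP fV]|[tV fV]].
  split=> // U hUV tU wU.
  by apply/ends_beforeP => //; move: (fV (inZp U)); rewrite tU wU.
rewrite /unshadowed tV /=; apply/forallP => u; apply/implyP => /andP[tu wu].
have [U [hU eU]] := inZp_lift (V - n) u; rewrite -eU.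
have hUV : (U <= V < U + N)%N by lia.
by apply/ends_beforeP => //; apply: fV; rewrite ?eU.
Qed.

Lemma S_step k : S k.+1 = S k + (if tt k then (ww k)%:Z else -1).
Proof. by rewrite psumS. Qed.

Lemma H_step k : H k.+1 = H k + (if tt k then -1 else (ww k)%:Z).
Proof. by rewrite psumS. Qed.

(** The walk descends by unit steps only and cannot jump over the level [S U]: the first later
    position not above that level lies exactly on it and is reached by a vertical edge. *)
Lemma first_return U V : (U < V)%N -> S U < S U.+1 -> S V <= S U ->
  exists E, [/\ (U < E < V)%N, ~~ tt E, S E.+1 = S U &
    forall j, (U < j <= E)%N -> S U < S j].
Proof.
move=> ltUV upU leS.
have exj : exists j, (U < j)%N && (S j <= S U) by exists V; rewrite ltUV.
case: (ex_minnP exj) => j /andP[ltUj leSj] min_j.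
have le_jV : (j <= V)%N by apply: min_j; rewrite ltUV.
have nej : j != U.+1 by apply: contraTneq leSj => ->; rewrite -ltNge.
case: j ltUj leSj min_j le_jV nej => [|E] // ltUj leSj min_j le_jV nej.
have above i : (U < i <= E)%N -> S U < S i.
  case/andP=> lt_i le_i; rewrite ltNge; apply/negP => le_Si.
  by have := min_j i; rewrite lt_i le_Si ltnNge => /(_ isT); rewrite le_i.
have abE := above E; have := S_step E; case: ifP => tE SE; first by lia.
by exists E; split=> //; lia.
Qed.

Lemma S_period k : S (k + N) = S k + \sum_i stepE t w i.
Proof. exact: psum_period. Qed.

(** Unshadowed edges are the strict records of the walk. If [V] is no record, the last position up
    to [V] not above [S V.+1] is followed by an up-step, whose horizontal edge sees no return before
    [V]. At a record, [first_return] ends every shadow before [V]. *)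
Lemma unshadowed_record V : \sum_i stepE t w i < 0 -> (N <= V)%N ->
  unshadowed t w (inZp V) <-> forall j, (j <= V)%N -> S V.+1 < S j.
Proof.
move=> drift leNV; rewrite unshadowedP; last lia.
split=> [[tV fV] j|recV].
  have SV := S_step V; rewrite (negbTE tV) in SV.
  move=> le_jV; rewrite ltNge; apply/negP => le_S.
  have exi : exists i, (i <= V)%N && (S i <= S V.+1) by exists j; rewrite le_jV.
  have bnd i : (i <= V)%N && (S i <= S V.+1) -> (i <= V)%N by case/andP.
  case: (ex_maxnP exi bnd) => i /andP[le_iV le_Si] max_i.
  have above k : (i < k <= V)%N -> S V.+1 < S k.
    case/andP=> lt_k le_k; rewrite ltNge; apply/negP => le_Sk.
    by have := max_i k; rewrite le_k le_Sk => /(_ isT); rewrite leqNgt lt_k.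
  have neiV : i <> V by move=> e; move: le_Si; rewrite e SV; lia.
  (* With negative drift a shift by one period goes lower still, so the last such position is less
     than a period away from [V]. *)
  have ltVi : (V < i + N)%N.
    rewrite ltnNge; apply/negP => le_i.
    have := max_i (i + N)%N; rewrite le_i S_period; lia.
  have := above i.+1; have := S_step i; case: ifP => ti; last by lia.
  move=> Si ab.
  have [||E [hE tE eE]] := fV i _ ti; [lia | lia |].
  have := above E.+1; lia.
have tV : ~~ tt V.
  by have := recV V; have := S_step V; case: ifP => //; lia.
have SV := S_step V; rewrite (negbTE tV) in SV.
split=> // U hUV tU wU.
have SU := S_step U; rewrite tU in SU.
have neUV : U <> V by move=> e; move: tV; rewrite -e tU.
have [|||E [hE tE eE _]] := @first_return U V; [lia|lia| |by exists E; split=> //; lia].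
by have := recV U; lia.
Qed.

Fixpoint running_min (k : nat) : int :=
  if k is k'.+1 then Num.min (running_min k') (S k) else 0.

Lemma running_minS k : running_min k.+1 = Num.min (running_min k) (S k.+1).
Proof. by []. Qed.

Lemma running_min_le k j : (j <= k)%N -> running_min k <= S j.
Proof.
elim: k => [|k IH]; first by case: j => //; rewrite psum0.
rewrite leq_eqVlt => /orP[/eqP->|]; first by rewrite /= ge_min lexx orbT.
by rewrite ltnS => /IH h; rewrite /= ge_min h.
Qed.

Lemma running_min_attained k : exists2 j, (j <= k)%N & running_min k = S j.
Proof.
elim: k => [|k [j le_j e]]; first by exists 0%N; rewrite ?psum0.
rewrite /=; case: leP => _; first by exists j => //; lia.
by exists k.+1.
Qed.

(** Each position of the first period has a lower copy in the second, so the minimum moves down by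
    exactly the drift. *)
Lemma running_min_period : \sum_i stepE t w i < 0 ->
  running_min (N + N) = running_min N + \sum_i stepE t w i.
Proof.
move=> drift; apply: le_anti; apply/andP; split.
  have [j le_j ->] := running_min_attained N.
  by rewrite -S_period; apply: running_min_le; lia.
have [j le_j ej] := running_min_attained (N + N).
have [lt_jN|le_Nj] := ltnP j N.
  have le_jN : (j + N <= N + N)%N by lia.
  by have := running_min_le le_jN; rewrite ej S_period; lia.
rewrite ej -(subnK le_Nj) S_period lerD2r; apply: running_min_le; lia.
Qed.

(** The cycle lemma. Records are counted over the second period, since [unshadowed_record] needs a
    full period of past; there they account for the whole fall of the running minimum. *)
Lemma card_unshadowed : \sum_i stepE t w i < 0 ->
  #|[set v | unshadowed t w v]|%:Z = - \sum_i stepE t w i.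
Proof.
move=> drift.
pose f v : int := (unshadowed t w v : nat)%:Z.
(* The walk only goes down by unit steps, so each new minimum lowers the
   running minimum by exactly one. *)
have step k : psum f (N + k) - psum f N = running_min N - running_min (N + k).
  elim: k => [|k IH]; first by rewrite addn0 !subrr.
  rewrite !addnS psumS (running_minS (N + k)) addrAC IH -addrA.
  have leNk : (N <= N + k)%N by lia.
  have := unshadowed_record drift leNk; rewrite /f; case: (unshadowed _ _ _) => recP.
    have := recP.1 isT => rec.
    have [j le_j e] := running_min_attained (N + k).
    have := rec j le_j; have := running_min_le (leqnn (N + k)).
    have := S_step (N + k); rewrite minEle e; case: ifP; case: ifP; rewrite /=; lia.
  have [] := boolP (S (N + k).+1 < running_min (N + k)) => [lt|]; last first.
    by rewrite -leNgt => /min_idPl ->; rewrite addr0.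
  suff: false by []; apply/recP => j le_j.
  by apply: lt_le_trans lt _; apply: running_min_le.
have -> : #|[set v | unshadowed t w v]|%:Z = \sum_i f i.
  rewrite -sum1_card (big_morph _ PoszD (erefl _)) big_mkcond /=.
  by apply: eq_bigr => i _; rewrite inE /f; case: unshadowed.
have := step N; rewrite psum_period running_min_period //; lia.
Qed.

End Unrolled.

(** * Slope bound for gradings supported on the shadow *)

(** Comparison with the slope of the diagonal, cleared of denominators. The predecessor is the unit
    that a drop of [H] takes off the vertical weight of a first-return arc. *)
Definition slope_le (n : nat) (t : 'I_n -> bool) (d1 d2 : nat) : Prop :=
  forall u v : 'I_n, t u -> ~~ t v ->
    ((#|[set k : 'I_n | in_arc u v k && t k]|.-1 * d2 <
      #|[set k : 'I_n | in_arc u v k && ~~ t k]| * d1)%N).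

Section Bounds.
Variables (n : nat).
Notation N := n.+1.
Variables (t : 'I_N -> bool) (w : 'I_N -> nat).
Notation tt k := (t (inZp k)).
Notation ww k := (w (inZp k)).
Notation S := (psum (stepE t w)).
Notation H := (psum (stepN t w)).
Notation totE := (psum (fun k => if t k then (w k)%:Z else 0)).
Notation totN := (psum (fun k => if t k then 0 else (w k)%:Z)).
Let d1 := #|[set k | t k]|.
Let d2 := #|[set k | ~~ t k]|.

Hypothesis cw : gcompat t w.

(* The first V' after U at which the walk H is back at level H U would be a
   vertical edge incompatible with U. *)
Lemma arc_bound U V : (U < V <= U + N)%N -> tt U -> (0 < ww U)%N ->
  (forall j, (U < j < V)%N -> S U < S j) -> H V < H U.
Proof.
move=> hUV tU wU above; rewrite ltNge; apply/negP => leH.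
have exj : exists j, (U < j)%N && (H U <= H j) by exists V; rewrite leH; lia.
case: (ex_minnP exj) => j /andP[ltUj leHj] min_j.
have le_jV : (j <= V)%N by apply: min_j; rewrite leH; lia.
have HU := H_step t w U; rewrite tU in HU.
have nej : j <> U.+1 by move=> e; move: leHj; rewrite e HU; lia.
case: j ltUj leHj min_j le_jV nej => [|j] // ltUj leHj min_j le_jV nej.
have below i : (U < i <= j)%N -> H i < H U.
  case/andP=> lt_i le_i; rewrite ltNge; apply/negP => le_Hi.
  by have := min_j i; rewrite lt_i le_Hi ltnNge => /(_ isT); rewrite le_i.
have blj := below j; have := H_step t w j; case: ifP => tj Hj; first by lia.
have hUj : (U <= j < U + N)%N by lia.
have wj : (0 < ww j)%N by lia.
have [[E [hE _ eE]]|[E [hE _ eE]]] :=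
  (gcompatP t w).1 cw U j hUj tU (negbT tj) wU wj.
- by have := above E.+1; lia.
- by have := below E; lia.
Qed.

Hypothesis sl : slope_le t d1 d2.

(** [totN - H] counts the horizontal edges passed and [totE - S] the vertical ones, so [slope_le]
    can be read off the walks. *)
Lemma arc_slope U V : (U <= V < U + N)%N -> tt U -> ~~ tt V ->
  ((totN V.+1 - H V.+1) - (totN U - H U) - 1) * d2%:Z <
  ((totE V.+1 - S V.+1) - (totE U - S U)) * d1%:Z.
Proof.
move=> hUV tU tV; have := sl tU tV.
set cE := #|_|; set cN := #|_|.
have cE_gt0 : (0 < cE)%N.
  apply/card_gt0P; exists (inZp U).
  by rewrite inE tU andbT in_arc_inZp //; lia.
have -> : totN V.+1 - H V.+1 - (totN U - H U) = cE%:Z.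
  have : totN V.+1 - totN U - cE%:Z = H V.+1 - H U; last lia.
  rewrite -!psum_arc // sum_stepN; congr (_ - _).
  rewrite (big_morph _ PoszD (erefl _)) big_mkcondr /=.
  by apply: eq_bigr => k _; case: (t k).
have -> : totE V.+1 - S V.+1 - (totE U - S U) = cN%:Z.
  have : totE V.+1 - totE U - cN%:Z = S V.+1 - S U; last lia.
  rewrite -!psum_arc // sum_stepE; congr (_ - _).
  rewrite (big_morph _ PoszD (erefl _)) big_mkcondr /=.
  by apply: eq_bigr => k _; case: (t k).
by move: cE_gt0; case: cE => // c _; rewrite /= ; nia.
Qed.

(* Between two levels of the walk S that are minimal so far, the path splits
   into first-return arcs, edges of weight 0, and new minima. *)
Lemma scan_bound K L : (K <= L <= K + N)%N ->
  (forall j, (K <= j <= L)%N -> S L <= S j) ->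
  (forall V, (K <= V < L)%N -> ~~ tt V ->
     (forall j, (K <= j <= V)%N -> S V.+1 < S j) -> ww V = 0%N) ->
  (totE L = totE K /\ totN L = totN K) \/
  (totN L - totN K) * d2%:Z < (totE L - totE K) * d1%:Z.
Proof.
have [m] := ubnP (L - K); elim: m K => // m IH K ltm hKL minL zero.
have [-> | neKL] := eqVneq K L; first by left.
have ltKL : (K < L)%N by lia.
have SK := S_step t w K.
(* [S K'] is the lowest level since [K], so a new minimum relative to [K'] is also new relative to
   [K]. *)
have zeroS K' : (K < K')%N -> (forall j, (K <= j < K')%N -> S K' <= S j) ->
    forall V, (K' <= V < L)%N -> ~~ tt V ->
    (forall j, (K' <= j <= V)%N -> S V.+1 < S j) -> ww V = 0%N.
  move=> ltK' minK' V hV tV lowV; apply: zero => [||j hj] //; first by lia.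
  have [lejK'|ltjK'] := leqP K' j; first by apply: lowV; lia.
  by have := lowV K'; have := minK' j; lia.
have minS K' : (K < K')%N -> forall j, (K' <= j <= L)%N -> S L <= S j.
  by move=> ltK' j hj; apply: minL; lia.
(* An edge at [K] that does not rise carries no weight: it is horizontal of weight 0, or a new
   minimum covered by [zero]. *)
have [triv|trivE] := boolP (tt K ==> (ww K == 0)%N).
  have wK0 : ww K = 0%N.
    have [tK|tK] := boolP (tt K); first by move: triv; rewrite tK => /eqP.
    apply: zero => [||j hj] //; first by lia.
    have -> : j = K by lia.
    by move: SK; rewrite (negbTE tK); lia.
  have SK1 : S K.+1 <= S K by move: SK triv; case: ifP => //= _; lia.
  have [| | | |[eE eN]|bd] := IH K.+1; [lia | lia | | | |].
  - by apply: minS.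
  - apply: zeroS => // j hj; have -> : j = K by lia.
    exact: SK1.
  - left; rewrite eE eN !psumS; by rewrite wK0 !if_same !addr0.
  - right; move: bd; rewrite !psumS; by rewrite wK0 !if_same !addr0.
rewrite negb_imply in trivE; case/andP: trivE => tK wK.
rewrite tK in SK.
have leSL : S L <= S K by apply: minL; lia.
have [|E [hE tE SE above]] := first_return ltKL _ leSL; first by lia.
have hKE : (K <= E < K + N)%N by lia.
have Hlt : H E.+1 < H K.
  by apply: arc_bound; [lia | | lia | move=> j hj; apply: above; lia].
(* [S] is back at its level, so the horizontal weight of the arc equals its number of vertical
   edges; [H] has dropped, so the vertical weight is less than its number of horizontal edges. *)
have arc : (totN E.+1 - totN K) * d2%:Z < (totE E.+1 - totE K) * d1%:Z.
  have := arc_slope hKE tK tE; rewrite SE; nia.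
right.
have [| | | |[eE eN]|bd] := IH E.+1; [lia | lia | | | |].
- by apply: minS; lia.
- apply: zeroS => [|j hj]; first by lia.
  rewrite SE; have [->|ne] := eqVneq j K; first by [].
  by apply/ltW/above; lia.
- by rewrite eE eN.
- by have := ltrD bd arc; rewrite -!mulrDl !addrA !subrK.
Qed.

Lemma totE_total K : totE (K + N) = totE K + (sumE t w)%:Z.
Proof.
rewrite psum_period /sumE (big_morph _ PoszD (erefl _)) [in RHS]big_mkcond.
by congr (_ + _); apply: eq_bigr => k _; case: (t k).
Qed.

Lemma totN_total K : totN (K + N) = totN K + (sumN t w)%:Z.
Proof.
rewrite psum_period /sumN (big_morph _ PoszD (erefl _)) [in RHS]big_mkcond.
by congr (_ + _); apply: eq_bigr => k _; case: (t k).
Qed.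

(** The scan covers one period starting just after an unshadowed edge. That edge is a record, so
    minima new since the start are records too, hence unshadowed and of weight 0. *)
Lemma shadowed_bound : (forall v, unshadowed t w v -> w v = 0%N) ->
  (sumE t w < d2)%N ->
  (sumE t w = 0%N /\ sumN t w = 0%N) \/ (sumN t w * d2 < sumE t w * d1)%N.
Proof.
move=> zero ltE.
have totS := total_stepE t w; rewrite -/d2 in totS.
have drift : \sum_i stepE t w i < 0 by lia.
have /card_gt0P[v] : (0 < #|[set v | unshadowed t w v]|)%N.
  by have := card_unshadowed drift; lia.
rewrite inE => fv; have [V [hV eV]] := inZp_lift N v.
have NV : (N <= V)%N by lia.
rewrite -eV in fv; have rec := (unshadowed_record drift NV).1 fv.
have leK : (V.+1 <= V.+1 + N <= V.+1 + N)%N by lia.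
have [||[eE eN]|bd] := scan_bound leK.
- move=> j hj; rewrite -(@subnK N j); last lia.
  rewrite !S_period lerD2r; have [->|ne] := eqVneq (j - N)%N V.+1 => //.
  by apply/ltW/rec; lia.
- move=> V' hV' tV' low; apply: zero; apply/unshadowed_record => //; first by lia.
  move=> j hj; have [ltjV|lejV] := ltnP j V.+1; last by apply: low; lia.
  by apply: (lt_trans (low V.+1 _)); [lia | apply: rec; lia].
- by left; move: eE eN; rewrite totE_total totN_total; lia.
- by right; move: bd; rewrite totE_total totN_total; lia.
Qed.

Lemma last_argmin (f : nat -> int) m : (0 < m)%N ->
  exists2 K, (K < m)%N &
    forall j, (j < m)%N -> f K <= f j /\ ((K < j)%N -> f K < f j).
Proof.
elim: m => // -[_ _|m IH _]; first by exists 0%N => // -[|j].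
have [|K ltK minK] := IH; first by [].
have [le|lt] := leP (f m.+1) (f K).
  exists m.+1 => // j; rewrite ltnS leq_eqVlt => /orP[/eqP ->|lt_j].
    by split=> //; lia.
  by have [] := minK j lt_j; split; lia.
exists K; first by lia.
move=> j; rewrite ltnS leq_eqVlt => /orP[/eqP ->|lt_j]; last exact: minK.
by split=> //; apply: ltW.
Qed.

(** Start at the last minimum [K] of a period of [S]. Positive drift would keep [S] above [S K] for
    a whole period, so [arc_bound] would make [H] drop, against [d1 <= sumN]. Zero drift leaves no
    new minima, and the strict alternative of [scan_bound] contradicts the same inequality. *)
Lemma overfull_trivial : (d2 <= sumE t w)%N -> (d1 <= sumN t w)%N ->
  sumE t w = 0%N /\ sumN t w = 0%N.
Proof.
move=> leE leN.
have totS := total_stepE t w; rewrite -/d2 in totS.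
have totH := total_stepN t w; rewrite -/d1 in totH.
have [|K ltK minK] := @last_argmin S N; first by [].
have minP j : (K < j <= K + N)%N -> S K <= S j /\ ((d2 < sumE t w)%N -> S K < S j).
  move=> hj; have [ltj|lej] := ltnP j N.
    by have [h1 h2] := minK j ltj; split=> // _; apply: h2; lia.
  have [|h1 h2] := minK (j - N)%N; first by lia.
  by have := S_period t w (j - N); rewrite subnK //; split; lia.
have [ltE|geE] := ltnP d2 (sumE t w).
  have [|_ /(_ ltE) upK] := minP K.+1; first by lia.
  have := S_step t w K; case: ifP => tK SK; last by lia.
  have hK : (K < K + N <= K + N)%N by lia.
  have /(arc_bound hK tK) : (0 < ww K)%N by lia.
  rewrite psum_period => bd; suff: \sum_i stepN t w i < 0 by lia.
  suff: psum (stepN t w) K + \sum_i stepN t w i < psum (stepN t w) K by lia.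
  by apply: bd => j hj; apply: (minP j _).2 => //; lia.
have leK : (K <= K + N <= K + N)%N by lia.
have SKN := S_period t w K.
have [||[eE eN]|bd] := scan_bound leK.
- move=> j hj; have [->|ne] := eqVneq j K; first by lia.
  by have [|h _] := minP j; lia.
- move=> V hV _ /(_ K); have [|h _] := minP V.+1; lia.
- by move: eE eN; rewrite totE_total totN_total; lia.
- by move: bd; rewrite totE_total totN_total; nia.
Qed.

End Bounds.

(** * Factorization of the generating function *)

Section Locality.
Variables (n : nat) (t : 'I_n -> bool).
Implicit Types w : 'I_n -> nat.

Lemma eq_ends_before w w' u v : (forall k, t k -> w k = w' k) ->
  ends_before t w u v = ends_before t w' u v.
Proof.
move=> eqw; apply: eq_existsb => e; congr [&& _, _ & _ == _].
by apply: eq_bigr => k /andP[_ /eqw].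
Qed.

Lemma eq_unshadowed w w' v : (forall k, t k -> w k = w' k) ->
  unshadowed t w v = unshadowed t w' v.
Proof.
move=> eqw; rewrite /unshadowed; congr (_ && _); apply: eq_forallb => u.
by case: (boolP (t u)) => //= tu; rewrite (eqw u) // (@eq_ends_before w w').
Qed.

Lemma unshadowed_notE w k : t k -> ~~ unshadowed t w k.
Proof. by rewrite /unshadowed => ->. Qed.

Lemma eq_sumE w w' : (forall k, t k -> w k = w' k) -> sumE t w = sumE t w'.
Proof. by move=> eqw; apply: eq_bigr => k /eqw. Qed.

(** A shadow is an initial stretch of the edges after its source: once ended, it stays ended along
    the arc. *)
Lemma ends_before_arc w (u v k : 'I_n) : in_arc u v k ->
  ends_before t w u k -> ends_before t w u v.
Proof.
move=> arc_k /existsP[e /and3P[arc_e /andP[te ne] eqc]].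
apply/existsP; exists e; rewrite te eqc andbT.
have lts := (ltn_ord u, ltn_ord v, ltn_ord k, ltn_ord e).
move: arc_k arc_e ne; rewrite -!(inj_eq val_inj) /in_arc /=.
by do ![case: ifP]; lia.
Qed.

(** [ends_before] reads horizontal weights only. Where it fails for [u] and [v], the arc between
    them has no unshadowed edge, so [starts_after] reads only weights on which [w] and [w']
    agree. *)
Lemma gcompat_local w w' : (forall k, ~~ unshadowed t w k -> w k = w' k) ->
  gcompat t w -> gcompat t w'.
Proof.
move=> eqw cw; have eqE k : t k -> w k = w' k.
  by move/(unshadowed_notE w)/eqw.
apply/forallP => u; apply/forallP => v; apply/implyP.
case/andP=> /andP[tu tv]; rewrite muln_gt0 => /andP[wu wv].
rewrite -(@eq_ends_before w w') //; case: (boolP (ends_before t w u v)) => //= nb.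
have nfree (k : 'I_n) : in_arc u v k -> ~~ unshadowed t w k.
  move=> arc_k; apply: contra nb => /andP[_ /forallP/(_ u)].
  by rewrite tu eqE // wu /=; apply: ends_before_arc.
have fv : ~~ unshadowed t w v.
  by apply: nfree; rewrite /in_arc; case: ifP; lia.
have /forallP/(_ u)/forallP/(_ v) := cw.
rewrite tu tv eqE // (eqw v) // muln_gt0 wu wv (negbTE nb) /=.
case/existsP=> e /and3P[arc_e te /eqP eqc]; apply/existsP; exists e.
rewrite arc_e te eqc /=; apply/eqP/eq_bigr => k /andP[arc_k _].
apply/eqw/nfree; move: arc_e arc_k; rewrite /in_arc.
have lts := (ltn_ord u, ltn_ord v, ltn_ord k, ltn_ord e).
by do ![case: ifP]; lia.
Qed.

End Locality.

Definition wgt (A : comNzRingType) (n : nat) (t : 'I_n -> bool)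
  (al be : nat -> A) (w : 'I_n -> nat) : A :=
  \prod_(k : 'I_n) (if t k then be (w k) else al (w k)).

Section Factorization.
Variables (A : comNzRingType) (n M : nat) (t : 'I_n -> bool).
Variables (al be : nat -> A).
Hypothesis al0 : al 0%N = 1.
Notation W := {ffun 'I_n -> 'I_M.+1}.
Notation val w := (fun k => nat_of_ord (w k)).

Definition shadow_supported (w : W) : bool :=
  [forall k, unshadowed t (val w) k ==> (w k == ord0)].

Definition clear_unshadowed (w : W) : W :=
  [ffun k => if unshadowed t (val w) k then ord0 else w k].

Definition zterm (k : 'I_n) (j : 'I_M.+1) : {poly A} :=
  if t k then (be j)%:P else (al j)%:P * 'X^j.

Lemma prod_zterm (w : W) :
  \prod_k zterm k (w k) = (wgt t al be (val w))%:P * 'X^(sumN t (val w)).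
Proof.
rewrite /wgt /sumN rmorph_prod /= (big_morph _ (exprD _) (expr0 _)).
rewrite [X in _ * X]big_mkcond -big_split /=; apply: eq_bigr => k _.
by rewrite /zterm; case: (t k); rewrite ?mulr1.
Qed.

(** The truncated series of [al] is the contribution of one unshadowed edge. *)
Definition zpoly : {poly A} := \sum_(j < M.+1) (al j)%:P * 'X^j.

(** A fibre of [clear_unshadowed] is a product set, free on unshadowed edges and forced elsewhere;
    the sum over it therefore becomes a product over edges. *)
Lemma clear_unshadowed_fiber (w0 w : W) q :
  gcompat t (val w0) && (sumE t (val w0) == q) && shadow_supported w0 ->
  (gcompat t (val w) && (sumE t (val w) == q) && (clear_unshadowed w == w0)) =
  (w \in family (fun k => [pred j | unshadowed t (val w0) k || (j == w0 k)])).
Proof.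
case/andP=> /andP[c0 /eqP e0] /forallP u0; apply/idP/familyP.
  case/andP=> _ /eqP <- k; rewrite inE.
  rewrite (@eq_unshadowed _ _ _ (val w)) => [|j tj]; rewrite ffunE.
    by case: (unshadowed _ _ _) => //=.
  by rewrite (negbTE (unshadowed_notE _ tj)).
move=> wP; have agree k : ~~ unshadowed t (val w0) k -> val w0 k = val w k.
  by move=> nf; have := wP k; rewrite inE (negbTE nf) => /eqP ->.
have agreeE k : t k -> val w0 k = val w k.
  by move=> tk; apply/agree/unshadowed_notE.
rewrite (gcompat_local agree c0) -(eq_sumE agreeE) e0 eqxx /=.
apply/eqP/ffunP => k; rewrite ffunE -(eq_unshadowed _ agreeE).
have := u0 k; case: (boolP (unshadowed _ _ k)) => [_ /eqP -> // | /agree nf _].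
by apply: val_inj.
Qed.

Lemma factorization q m :
  (forall w : W, sumE t (val w) = q -> #|[set k | unshadowed t (val w) k]| = m) ->
  \sum_(w : W | gcompat t (val w) && (sumE t (val w) == q))
     \prod_k zterm k (w k) =
  (\sum_(w : W | gcompat t (val w) && (sumE t (val w) == q) && shadow_supported w)
     \prod_k zterm k (w k)) * zpoly ^+ m.
Proof.
move=> card_m.
rewrite (partition_big clear_unshadowed
  (fun w => gcompat t (val w) && (sumE t (val w) == q) && shadow_supported w)) /=; last first.
  move=> w /andP[cw eq_q].
  have agree k : ~~ unshadowed t (val w) k -> val w k = val (clear_unshadowed w) k.
    by rewrite /= ffunE => /negbTE ->.
  have agreeE k : t k -> val w k = val (clear_unshadowed w) k.
    by move=> tk; apply/agree/unshadowed_notE.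
  rewrite (gcompat_local agree cw) -(eq_sumE agreeE) eq_q /=.
  apply/forallP => k; rewrite -(eq_unshadowed _ agreeE) ffunE.
  by case: (unshadowed _ _ _).
rewrite big_distrl; apply: eq_bigr => w0 Qw0.
rewrite (eq_bigl _ _ (fun w => clear_unshadowed_fiber w Qw0)).
rewrite -(bigA_distr_big_dep (fun k j => unshadowed t (val w0) k || (j == w0 k)) zterm).
case/andP: Qw0 => /andP[_ /eqP e0] /forallP u0.
rewrite -(card_m w0 e0) -prodr_const (bigID (unshadowed t (val w0))) /= mulrC; congr (_ * _).
  rewrite [RHS](bigID (unshadowed t (val w0))) /= [X in X * _]big1 ?mul1r => [|k fk].
    by apply: eq_bigr => k /negbTE fk; rewrite fk big_pred1_eq.
  (* Unshadowed edges are vertical and have weight 0 in [w0], so their factor is [al 0 = 1]. *)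
  have := u0 k; rewrite fk => /eqP ->; rewrite /zterm al0.
  by have := fk; rewrite /unshadowed => /andP[/negbTE -> _]; rewrite mulr1.
apply: eq_big => [k|k fk]; rewrite ?inE // fk /=.
by apply: eq_bigr => j _; rewrite /zterm; case/andP: fk => /negbTE ->.
Qed.

End Factorization.

(** * Power series and coefficientwise maximum *)

Lemma eq_coef_exp (A : comNzRingType) (p r : {poly A}) m k :
  (forall i, (i <= k)%N -> p`_i = r`_i) ->
  forall i, (i <= k)%N -> (p ^+ m)`_i = (r ^+ m)`_i.
Proof.
move=> eq_pr; elim: m => // m IH i le_ik; rewrite !exprS !coefM.
apply: eq_bigr => j _; have ltj := ltn_ord j.
by rewrite eq_pr ?IH //; lia.
Qed.

(** [I] inverts [P] only up to degree [M], which suffices for the coefficient of degree [p <= M]. *)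
Lemma deconvolution (A : comNzRingType) (G R P I : {poly A}) M m p :
  G = R * P ^+ m -> (forall k, (k <= M)%N -> (P * I)`_k = (k == 0%N)%:R) ->
  (p <= M)%N -> \sum_(k < p.+1) G`_(p - k) * (I ^+ m)`_k = R`_p.
Proof.
move=> -> PI le_pM; rewrite -coefMr -mulrA -exprMn -[in RHS](mulr1 R) !coefM.
apply: eq_bigr => j _; congr (_ * _).
rewrite (@eq_coef_exp _ _ 1 _ M) ?expr1n; [by []| |by lia].
by move=> i /PI ->; rewrite coef1.
Qed.

Section InverseSeries.
Variable a : nat -> Pol.
Hypothesis a0 : a 0%N = 1.

Definition invc (i : nat) : Pol := (inv_coefs a i)`_i.

Lemma size_inv_coefs m : size (inv_coefs a m) = m.+1.
Proof. by elim: m => //= m IH; rewrite size_rcons IH. Qed.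

Lemma nth_inv_coefs m i : (i <= m)%N -> (inv_coefs a m)`_i = invc i.
Proof.
elim: m => [|m IH]; first by case: i.
rewrite leq_eqVlt => /orP[/eqP -> //|lt_i].
by rewrite /= nth_rcons size_inv_coefs lt_i IH.
Qed.

Lemma inv_coefsS m : inv_coefs a m.+1 = rcons (inv_coefs a m)
  (- \sum_(k < m.+1) a k.+1 * (inv_coefs a m)`_(m - k)).
Proof. by []. Qed.

Lemma invcS m : invc m.+1 = - \sum_(k < m.+1) a k.+1 * invc (m - k).
Proof.
have -> : invc m.+1 = (inv_coefs a m.+1)`_m.+1 by [].
rewrite inv_coefsS nth_rcons size_inv_coefs ltnn eqxx; apply: (congr1 -%R).
by apply: eq_bigr => k _; rewrite nth_inv_coefs // leq_subr.
Qed.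

Lemma coef_zpoly M i : (i <= M)%N -> (zpoly M a)`_i = a i.
Proof.
rewrite -ltnS => lt_i; rewrite /zpoly coef_sum (bigD1 (Ordinal lt_i)) //=.
rewrite coefCM coefXn eqxx mulr1 big1 ?addr0 // => j ne_j.
rewrite coefCM coefXn; case: eqP => [e|]; last by rewrite mulr0.
by case/eqP: ne_j; apply: val_inj.
Qed.

Lemma zpoly_inv M k : (k <= M)%N ->
  (zpoly M a * Poly (inv_coefs a M))`_k = (k == 0%N)%:R.
Proof.
move=> le_kM; rewrite coefM.
rewrite (eq_bigr (fun j : 'I_k.+1 => a j * invc (k - j))) => [|j _]; last first.
  have ltj := ltn_ord j.
  by rewrite coef_zpoly ?coef_Poly ?nth_inv_coefs //; lia.
case: k le_kM => [|k] le_kM; first by rewrite big_ord1 a0 mul1r.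
by rewrite big_ord_recl a0 mul1r subn0 invcS; apply: addNr.
Qed.

(** Coefficients of the inverse series do not depend on the truncation order, so one order [M]
    serves every [k]. *)
Lemma vsig_coef M m k : (k <= M)%N ->
  vsig m%:Z k a = (Poly (inv_coefs a M) ^+ m)`_k.
Proof.
move=> le_kM; apply: (@eq_coef_exp _ _ _ _ k) => // i le_ik.
by rewrite !coef_Poly !nth_inv_coefs //; lia.
Qed.

Lemma vsig0 m : vsig m 0 a = 1.
Proof.
case: m => // m; rewrite (@vsig_coef 0) //.
elim: m => [|m IH]; first by rewrite coef1.
by rewrite exprS coefM big_ord1 IH mulr1 coef_Poly.
Qed.

Lemma vsig_npos m k : m <= 0 -> (0 < k)%N -> vsig m k a = 0.
Proof. by case: m => [[|//]|m] _ k_gt0; rewrite /= ?coef1; case: k k_gt0. Qed.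

End InverseSeries.

Lemma tmaxE f g m : (tmax f g)@_m = Num.max f@_m g@_m.
Proof.
rewrite /tmax mcoeffE in_fsetU.
have [|out_f] := boolP (m \in msupp f) => //=.
have [//|out_g] := boolP (m \in msupp g).
by rewrite !mcoeff_outdom // maxxx.
Qed.

Definition nonneg_coefs (f : Pol) : Prop := forall m, 0 <= f@_m.

Lemma nonneg_sum (I : Type) (s : seq I) (P : pred I) (F : I -> Pol) :
  (forall i, P i -> nonneg_coefs (F i)) -> nonneg_coefs (\sum_(i <- s | P i) F i).
Proof.
move=> FP; apply: big_ind => // [m|f g fP gP m]; first by rewrite mcoeff0.
by rewrite mcoeffD addr_ge0.
Qed.

Lemma nonneg_prod (I : Type) (s : seq I) (P : pred I) (F : I -> Pol) :
  (forall i, P i -> nonneg_coefs (F i)) -> nonneg_coefs (\prod_(i <- s | P i) F i).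
Proof.
move=> FP; apply: big_ind => // [m|f g fP gP m]; first by rewrite mcoeff1 ler0n.
rewrite mcoeffMl; apply: sumr_ge0 => k1 _; apply: sumr_ge0 => k2 _.
by rewrite mulrn_wge0 // mulr_ge0.
Qed.

Lemma nonneg_pv l i k : nonneg_coefs (pv l i k).
Proof.
move=> m; rewrite /pv; case: ifP => _; first by rewrite mcoeff1 ler0n.
by case: ifP => _; rewrite ?mcoeff0 // /Xv mcoeffU mulrn_wge0.
Qed.

(** Both arguments are coefficientwise at most [e], and one of them equals [e]. *)
Lemma tmax_dichotomy (e r r' : Pol) : nonneg_coefs r -> nonneg_coefs r' ->
  r = 0 \/ r' = 0 -> tmax (e - r) (e - r') = e.
Proof.
move=> r_ge0 r'_ge0 h; apply/malgP => m; rewrite tmaxE !mcoeffB.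
have := r_ge0 m; have := r'_ge0 m.
by case: h => ->; rewrite mcoeff0 subr0 maxEle; case: ifP; lia.
Qed.

(** * Generating functions of compatible and of shadow-supported gradings *)

Section AnyLength.
Variables (n : nat) (t : 'I_n -> bool) (w : 'I_n -> nat).
Notation d1 := #|[set k | t k]|.
Notation d2 := #|[set k | ~~ t k]|.

Lemma card_unshadowedE : (sumE t w < d2)%N ->
  #|[set k | unshadowed t w k]| = (d2 - sumE t w)%N.
Proof.
case: n t w => [|n'] t' w' lt_q.
  by have := max_card [set k | ~~ t' k]; rewrite card_ord; lia.
have tot := total_stepE t' w'.
by have := @card_unshadowed _ t' w'; rewrite tot; lia.
Qed.

Lemma shadowed_boundE : slope_le t d1 d2 -> gcompat t w ->
  (forall v, unshadowed t w v -> w v = 0%N) -> (sumE t w < d2)%N ->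
  (sumE t w = 0%N /\ sumN t w = 0%N) \/ (sumN t w * d2 < sumE t w * d1)%N.
Proof.
case: n t w => [|n'] t' w' sl cw zero lt_q; last exact: shadowed_bound.
by have := max_card [set k | ~~ t' k]; rewrite card_ord; lia.
Qed.

Lemma overfull_trivialE : slope_le t d1 d2 -> gcompat t w ->
  (d2 <= sumE t w)%N -> (d1 <= sumN t w)%N -> sumE t w = 0%N /\ sumN t w = 0%N.
Proof.
case: n t w => [|n'] t' w' sl cw; last exact: overfull_trivial.
by rewrite /sumE /sumN !big_ord0.
Qed.

End AnyLength.

Section Half.
Variables (n M : nat) (t : 'I_n -> bool) (al be : nat -> Pol).
Notation W := {ffun 'I_n -> 'I_M.+1}.
Notation val w := (fun k => nat_of_ord (w k)).
Let d1 := #|[set k | t k]|.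
Let d2 := #|[set k | ~~ t k]|.

Definition compat_sum (p q : nat) : Pol :=
  \sum_(w : W | gcompat t (val w) && (sumN t (val w) == p) && (sumE t (val w) == q))
     wgt t al be (val w).

(** For fixed [q] these are the coefficients of the factor left after dividing by the power of
    [zpoly]. *)
Definition shadow_sum (p q : nat) : Pol :=
  \sum_(w : W | [&& gcompat t (val w), sumN t (val w) == p, sumE t (val w) == q
                   & shadow_supported t w]) wgt t al be (val w).

Lemma coef_zterm_sum (Q : pred W) p :
  (\sum_(w | Q w) \prod_k zterm t al be k (w k))`_p =
  \sum_(w | Q w && (sumN t (val w) == p)) wgt t al be (val w).
Proof.
rewrite coef_sum big_mkcondr; apply: eq_bigr => w _.
rewrite prod_zterm coefCM coefXn eq_sym.
by case: eqP; rewrite ?mulr1 ?mulr0.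
Qed.

Hypothesis al0 : al 0%N = 1.

Lemma compat_sum_vsig p q : (q < d2)%N -> (p <= M)%N ->
  \sum_(k < p.+1) compat_sum (p - k) q * vsig (d2 - q)%N%:Z k al = shadow_sum p q.
Proof.
move=> lt_q le_p.
have card_m (w : W) : sumE t (val w) = q ->
    #|[set k | unshadowed t (val w) k]| = (d2 - q)%N.
  by move=> eq_q; rewrite card_unshadowedE eq_q.
have fact := factorization be al0 card_m.
have := deconvolution fact (zpoly_inv al0 (M := M)) le_p.
rewrite !coef_zterm_sum => eq_p.
rewrite /shadow_sum; apply: etrans (etrans eq_p _).
  apply: eq_bigr => k _; have ltk := ltn_ord k.
  rewrite (@vsig_coef al M); last lia.
  congr (_ * _); rewrite coef_zterm_sum; apply: eq_bigl => w.
  by rewrite andbAC.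
by apply: eq_bigl => w; rewrite -!andbA; do !bool_congr.
Qed.

Hypothesis sl : slope_le t d1 d2.

Lemma shadow_sum_bound p q : (q < d2)%N ->
  shadow_sum p q = 0 \/ (p = 0%N /\ q = 0%N) \/ (p * d2 < q * d1)%N.
Proof.
move=> lt_q; rewrite /shadow_sum.
case: (pickP (fun w : W => [&& gcompat t (val w), sumN t (val w) == p,
  sumE t (val w) == q & shadow_supported t w])) => [w|none]; last first.
  by left; rewrite big_pred0.
case/and4P=> cw /eqP wp /eqP wq /forallP sw; right.
have zero (v : 'I_n) : unshadowed t (val w) v -> nat_of_ord (w v) = 0%N.
  by move=> fv; have := sw v; rewrite fv => /eqP ->.
have := shadowed_boundE sl cw zero; rewrite wq wp -/d1 -/d2 => /(_ lt_q).
by case=> [[-> ->]|]; [left | right].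
Qed.

Lemma compat_sum_overfull p q : (d2 <= q)%N -> (d1 <= p)%N ->
  (0 < p + q)%N -> compat_sum p q = 0.
Proof.
move=> le_q le_p pq_gt0; rewrite /compat_sum big_pred0 // => w.
apply/negP => /andP[/andP[cw /eqP wp] /eqP wq].
have := overfull_trivialE sl cw; rewrite wp wq => /(_ le_q le_p); lia.
Qed.

End Half.

(** * Reflection *)

Lemma in_arc_rev n (u v k : 'I_n) :
  in_arc (rev_ord v) (rev_ord u) (rev_ord k) = in_arc u v k.
Proof.
have ltu := ltn_ord u; have ltv := ltn_ord v; have ltk := ltn_ord k.
by rewrite /in_arc /=; do ![case: ifP]; lia.
Qed.

Section Reversal.
Variables (n : nat) (t t' : 'I_n -> bool).
(* Reflection exchanging the two ends of the path and the two edge types. *)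
Hypothesis t'E : forall k, t' k = ~~ t (rev_ord k).

Lemma card_arc_rev (P P' : pred 'I_n) (u v : 'I_n) :
  (forall k, P' (rev_ord k) = P k) ->
  #|[set k : 'I_n | in_arc (rev_ord v) (rev_ord u) k && P' k]| =
  #|[set k : 'I_n | in_arc u v k && P k]|.
Proof.
move=> PE; rewrite -!sum1_card (reindex_inj rev_ord_inj) /=.
by apply: eq_bigl => k; rewrite !inE PE in_arc_rev.
Qed.

Lemma card_rev (P P' : pred 'I_n) : (forall k, P' (rev_ord k) = P k) ->
  #|[set k | P' k]| = #|[set k | P k]|.
Proof.
move=> PE; rewrite -!sum1_card (reindex_inj rev_ord_inj) /=.
by apply: eq_bigl => k; rewrite !inE PE.
Qed.

Lemma type_rev k : t' (rev_ord k) = ~~ t k.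
Proof. by rewrite t'E rev_ordK. Qed.

Lemma type_revN k : ~~ t' (rev_ord k) = t k.
Proof. by rewrite type_rev negbK. Qed.

Section Grading.
Variables (w w' : 'I_n -> nat).
Hypothesis w'E : forall k, w' k = w (rev_ord k).

Lemma grade_rev k : w' (rev_ord k) = w k.
Proof. by rewrite w'E rev_ordK. Qed.

Lemma sum_arc_rev (P P' : pred 'I_n) (u v : 'I_n) :
  (forall k, P' (rev_ord k) = P k) ->
  (\sum_(k : 'I_n | in_arc (rev_ord v) (rev_ord u) k && P' k) w' k =
   \sum_(k : 'I_n | in_arc u v k && P k) w k)%N.
Proof.
move=> PE; rewrite (reindex_inj rev_ord_inj) /=.
by apply: eq_big => k; rewrite ?grade_rev // PE in_arc_rev.
Qed.

(** Reflection reverses arcs and exchanges edge types, hence it interchanges the two alternatives of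
    compatibility. *)
Lemma ends_before_rev (u v : 'I_n) :
  ends_before t' w' (rev_ord v) (rev_ord u) = starts_after t w u v.
Proof.
have termE e : [&& in_arc (rev_ord v) (rev_ord u) (rev_ord e),
      ~~ t' (rev_ord e) && (rev_ord e != rev_ord u) &
      #|[set k : 'I_n | in_arc (rev_ord v) (rev_ord e) k && ~~ t' k]| ==
      (\sum_(k : 'I_n | in_arc (rev_ord v) (rev_ord e) k && t' k) w' k)%N] =
    [&& in_arc u v e, t e && (e != u) &
      #|[set k : 'I_n | in_arc e v k && t k]| ==
      (\sum_(k : 'I_n | in_arc e v k && ~~ t k) w k)%N].
  rewrite in_arc_rev type_revN (inj_eq rev_ord_inj) (card_arc_rev _ _ type_revN).
  by rewrite (sum_arc_rev _ _ type_rev).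
apply/existsP/existsP => -[e he]; exists (rev_ord e).
  by rewrite -termE rev_ordK.
by rewrite termE.
Qed.

Lemma starts_after_rev (u v : 'I_n) :
  starts_after t' w' (rev_ord v) (rev_ord u) = ends_before t w u v.
Proof.
have termE e : [&& in_arc (rev_ord v) (rev_ord u) (rev_ord e),
      t' (rev_ord e) && (rev_ord e != rev_ord v) &
      #|[set k : 'I_n | in_arc (rev_ord e) (rev_ord u) k && t' k]| ==
      (\sum_(k : 'I_n | in_arc (rev_ord e) (rev_ord u) k && ~~ t' k) w' k)%N] =
    [&& in_arc u v e, ~~ t e && (e != v) &
      #|[set k : 'I_n | in_arc u e k && ~~ t k]| ==
      (\sum_(k : 'I_n | in_arc u e k && t k) w k)%N].
  rewrite in_arc_rev type_rev (inj_eq rev_ord_inj) (card_arc_rev _ _ type_rev).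
  by rewrite (sum_arc_rev _ _ type_revN).
apply/existsP/existsP => -[e he]; exists (rev_ord e).
  by rewrite -termE rev_ordK.
by rewrite termE.
Qed.

Lemma gcompat_rev : gcompat t' w' = gcompat t w.
Proof.
have termE (u v : 'I_n) :
    (t' (rev_ord v) && ~~ t' (rev_ord u) && (0 < w' (rev_ord v) * w' (rev_ord u))%N ==>
      (ends_before t' w' (rev_ord v) (rev_ord u) ||
       starts_after t' w' (rev_ord v) (rev_ord u))) =
    (t u && ~~ t v && (0 < w u * w v)%N ==>
      (ends_before t w u v || starts_after t w u v)).
  rewrite ends_before_rev starts_after_rev type_rev type_revN !grade_rev.
  by rewrite mulnC (andbC (~~ _)) orbC.
apply/forallP/forallP => cw u; apply/forallP => v.
  by rewrite -termE; have /forallP := cw (rev_ord v); apply.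
have /forallP/(_ (rev_ord u)) := cw (rev_ord v).
by rewrite -termE !rev_ordK.
Qed.

Lemma sumN_rev : sumN t' w' = sumE t w.
Proof.
rewrite /sumN (reindex_inj rev_ord_inj) /=.
by apply: eq_big => k; rewrite ?type_revN ?grade_rev.
Qed.

Lemma sumE_rev : sumE t' w' = sumN t w.
Proof.
rewrite /sumE (reindex_inj rev_ord_inj) /=.
by apply: eq_big => k; rewrite ?type_rev ?grade_rev.
Qed.

Lemma wgt_rev (A : comNzRingType) (al be : nat -> A) :
  wgt t' be al w' = wgt t al be w.
Proof.
rewrite /wgt (reindex_inj rev_ord_inj) /=; apply: eq_bigr => k _.
by rewrite type_rev grade_rev; case: (t k).
Qed.

End Grading.

(** Through this bijection the second sum of the recursion becomes a first sum, for the reflected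
    path. *)
Lemma compat_sum_rev M al be p q :
  compat_sum M t' be al q p = compat_sum M t al be p q.
Proof.
pose rev_grading (w : {ffun 'I_n -> 'I_M.+1}) := [ffun k => w (rev_ord k)].
have rgK : involutive rev_grading.
  by move=> w; apply/ffunP => k; rewrite !ffunE rev_ordK.
rewrite /compat_sum (reindex_inj (inv_inj rgK)) /=; apply: eq_big => w.
  have rgE k : nat_of_ord (rev_grading w k) = w (rev_ord k) by rewrite ffunE.
  pose vw k := nat_of_ord (w k).
  by rewrite [gcompat t' _](@gcompat_rev vw _ rgE) [sumN t' _](@sumN_rev vw _ rgE)
    [sumE t' _](@sumE_rev vw _ rgE) andbAC.
by move=> _; apply: wgt_rev => k; rewrite ffunE.
Qed.

Lemma slope_le_rev d1 d2 :
  (forall u v : 'I_n, t u -> ~~ t v ->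
    ((#|[set k : 'I_n | in_arc u v k && ~~ t k]|.-1 * d1 <
      #|[set k : 'I_n | in_arc u v k && t k]| * d2)%N)) ->
  slope_le t' d2 d1.
Proof.
move=> sl u v; rewrite -(rev_ordK u) -(rev_ordK v) type_rev type_revN => tu tv.
by rewrite (card_arc_rev _ _ type_rev) (card_arc_rev _ _ type_revN); apply: sl.
Qed.

End Reversal.

(** * The Dyck path *)

Lemma steps_nth a b fuel x y k : (k < fuel)%N ->
  let s := steps a b fuel x y in
  nth false s k =
  ~~ ((y + \sum_(i < k) ~~ nth false s i).+1 * a <=
      b * (x + \sum_(i < k) nth false s i))%N.
Proof.
elim: fuel x y k => // f IH x y [|k] ltk /=.
  by rewrite !big_ord0 !addn0; case: ifP.
by case: ifP => _ /=; rewrite IH // !big_ord_recl /= ?add0n ?addn0 !addnA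
   ?addSn ?addn0 ?addn1.
Qed.

Section Path.
Variables (n a b : nat).
Notation N := n.+1.
Hypothesis eN : N = (a + b)%N.
Notation t := (fun k : 'I_N => isE a b k).
Notation X := (psum (fun k : 'I_N => (isE a b k : nat)%:Z)).
Notation Y := (psum (fun k : 'I_N => (~~ isE a b k : nat)%:Z)).

Lemma prefix_psum (f : nat -> bool) k : (k <= N)%N ->
  psum (fun i : 'I_N => (f i : nat)%:Z) k = (\sum_(i < k) f i)%N%:Z.
Proof.
move=> le_k; rewrite /psum big_mkord (big_morph _ PoszD (erefl _)).
by apply: eq_bigr => i _; rewrite /= modn_small //; have := ltn_ord i; lia.
Qed.

Lemma isE_prefix k : (k < N)%N ->
  isE a b k = ~~ ((Y k + 1) * a%:Z <= b%:Z * X k).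
Proof.
move=> ltk; rewrite (@prefix_psum (isE a b)) ?(@prefix_psum (fun k => ~~ isE a b k)); try lia.
by rewrite /isE /dpath steps_nth -?eN // !add0n -addn1 -PoszD -!PoszM lez_nat.
Qed.

(** The path stays in the rectangle: an east step at [X = a] would need [Y >= b], against
    [k < a + b]; the diagonal bound handles north steps. *)
Lemma prefix_counts k : (k <= N)%N ->
  [/\ X k + Y k = k%:Z, 0 <= X k <= a%:Z, 0 <= Y k <= b%:Z &
      Y k * a%:Z <= b%:Z * X k].
Proof.
elim: k => [|k IH] ltk; first by rewrite !psum0; split; lia.
have [|eXY hX hY hab] := IH; first by lia.
have := isE_prefix ltk; rewrite !psumS /= modn_small //.
by case: (isE a b k) => /=; rewrite ?addr0 => hk; split; nia.
Qed.

Lemma total_counts : X N = a%:Z /\ Y N = b%:Z.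
Proof. by have [eXY hX hY _] := prefix_counts (leqnn N); lia. Qed.

Lemma card_isE : #|[set k : 'I_N | isE a b k]| = a /\
  #|[set k : 'I_N | ~~ isE a b k]| = b.
Proof.
have [eX eY] := total_counts.
have cnt (P : pred 'I_N) : #|[set k | P k]|%:Z = psum (fun k => (P k : nat)%:Z) N.
  rewrite psum_total -sum1_card.
  rewrite (big_morph _ PoszD (erefl _)) big_mkcond /=.
  by apply: eq_bigr => k _; rewrite inE; case: (P k).
by split; apply/eqP; rewrite -eqz_nat cnt ?eX ?eY.
Qed.

(** One period adds [a] to [X] and [b] to [Y], hence [a * b] to both sides of the test. *)
Lemma isE_unrolled k : isE a b (inZp k : 'I_N) = ~~ ((Y k + 1) * a%:Z <= b%:Z * X k).
Proof.
have [eX eY] := total_counts.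
have totX k' : X (k' + N) = X k' + a%:Z.
  by rewrite psum_period -eX psum_total.
have totY k' : Y (k' + N) = Y k' + b%:Z.
  by rewrite psum_period -eY psum_total.
rewrite {2 3}(divn_eq k N) /=; elim: (k %/ N)%N => [|c IH].
  by rewrite mul0n add0n isE_prefix // ltn_mod.
rewrite IH mulSn -addnA (addnC N) totX totY; congr (~~ _); apply/idP/idP; nia.
Qed.

Lemma below_diagonal k : Y k * a%:Z <= b%:Z * X k.
Proof.
elim: k => [|k IH]; first by rewrite !psum0; lia.
have := isE_unrolled k; rewrite !psumS.
by case: (isE a b _) => /= hk; nia.
Qed.

(** A horizontal step establishes the bound, being taken only when a vertical one would pass above
    the diagonal; a vertical step cannot decrease the right side. *)
Lemma near_diagonal U k : isE a b (inZp U : 'I_N) -> (U <= k)%N ->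
  b%:Z * (X k.+1 - 1) < (Y k.+1 + 1) * a%:Z.
Proof.
move=> tU; elim: k => [|k IH] le_Uk.
  have := isE_unrolled 0; have -> : inZp 0 = inZp U :> 'I_N by congr inZp; lia.
  by rewrite tU !(psumS _ 0) !psum0; nia.
have := isE_unrolled k.+1; rewrite !(psumS _ k.+1).
have [eU|neU] := eqVneq U k.+1; first by rewrite -eU tU => hk; nia.
have := IH (_ : (U <= k)%N); case: (isE a b _) => /= nearV hk.
  by nia.
have := nearV ltac:(lia); nia.
Qed.

Lemma card_arc_psum (P : pred 'I_N) U V : (U <= V < U + N)%N ->
  #|[set k : 'I_N | in_arc (inZp U : 'I_N) (inZp V : 'I_N) k && P k]|%:Z =
  psum (fun k => (P k : nat)%:Z) V.+1 - psum (fun k => (P k : nat)%:Z) U.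
Proof.
move=> hUV; rewrite -psum_arc // -sum1_card (big_morph _ PoszD (erefl _)).
rewrite big_mkcond [RHS]big_mkcond; apply: eq_bigr => k _; rewrite inE.
by case: (in_arc _ _ _) => //=; case: (P k).
Qed.

(** The first bound combines [near_diagonal] at the end of the arc with [below_diagonal] at its
    start; the second combines [below_diagonal] at the end with the choice of a horizontal step at
    the start. *)
Lemma path_slope (u v : 'I_N) : isE a b u -> ~~ isE a b v ->
  (#|[set k : 'I_N | in_arc u v k && isE a b k]|.-1 * b <
   #|[set k : 'I_N | in_arc u v k && ~~ isE a b k]| * a)%N /\
  (#|[set k : 'I_N | in_arc u v k && ~~ isE a b k]|.-1 * a <
   #|[set k : 'I_N | in_arc u v k && isE a b k]| * b)%N.
Proof.
rewrite -(valZpK u) => tU.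
have [V [hV <-]] := inZp_lift u v => tV.
have := card_arc_psum (fun k => isE a b k) hV.
have := card_arc_psum (fun k => ~~ isE a b k) hV.
have gt0E :
  (0 < #|[set k : 'I_N | in_arc (inZp u : 'I_N) (inZp V : 'I_N) k
                         && isE a b k]|)%N.
  by apply/card_gt0P; exists (inZp u); rewrite inE tU andbT in_arc_inZp //; lia.
have gt0N :
  (0 < #|[set k : 'I_N | in_arc (inZp u : 'I_N) (inZp V : 'I_N) k
                         && ~~ isE a b k]|)%N.
  by apply/card_gt0P; exists (inZp V); rewrite inE tV andbT in_arc_inZp //; lia.
move: gt0E gt0N; set cE := #|_|; set cN := #|_| => gt0E gt0N eN' eE'.
have lowU := below_diagonal u; have lowV := below_diagonal V.+1.
have highU := isE_unrolled u; rewrite tU in highU.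
have neUV : (u : nat) <> V by move=> e; move: tV; rewrite -e tU.
have [k eV] : exists k, V = k.+1 by exists V.-1; lia.
have leUk : (u <= k)%N by lia.
have := near_diagonal tU leUk; rewrite -eV.
have eX : X V.+1 = X V by rewrite psumS (negbTE tV) addr0.
have eY : Y V.+1 = Y V + 1 by rewrite psumS tV.
move=> nearV; move: lowU lowV highU eN' eE'; rewrite eX eY.
case: cE gt0E => // cE _; case: cN gt0N => // cN _ /=.
by move=> *; split; nia.
Qed.

End Path.

Lemma dyck_path_slope n a b : n = (a + b)%N ->
  [/\ #|[set k : 'I_n | isE a b k]| = a, #|[set k : 'I_n | ~~ isE a b k]| = b &
   forall u v : 'I_n, isE a b u -> ~~ isE a b v ->
    (#|[set k : 'I_n | in_arc u v k && isE a b k]|.-1 * b <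
     #|[set k : 'I_n | in_arc u v k && ~~ isE a b k]| * a)%N /\
    (#|[set k : 'I_n | in_arc u v k && ~~ isE a b k]|.-1 * a <
     #|[set k : 'I_n | in_arc u v k && isE a b k]| * b)%N].
Proof.
case: n => [|n] eN; last first.
  by have [? ?] := card_isE eN; split=> // u v; apply: path_slope.
split; last by case.
  by have := max_card [set k : 'I_0 | isE a b k]; rewrite card_ord; lia.
by have := max_card [set k : 'I_0 | ~~ isE a b k]; rewrite card_ord; lia.
Qed.

(** * The recursion *)

(** Adding the missing term [k = 0], which is [g p] up to sign, completes the sum to a
    convolution. *)
Lemma sum_recursion (A : comNzRingType) (g v : nat -> A) p : v 0%N = 1 ->
  \sum_(1 <= k < p.+1) - g (p - k)%N * v k = g p - \sum_(k < p.+1) g (p - k)%N * v k.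
Proof.
move=> v0; rewrite big_ord_recl v0 mulr1 subn0 opprD addNKr big_add1 big_mkord -sumrN.
by apply: eq_bigr => k _; rewrite mulNr.
Qed.

Section Residue.
Variables (n M : nat) (t : 'I_n -> bool) (al be : nat -> Pol).
Notation d1 := #|[set k | t k]|.
Notation d2 := #|[set k | ~~ t k]|.
Hypothesis al0 : al 0%N = 1.
Hypothesis be0 : be 0%N = 1.

(* The branch d2 <= q matches the convention varsigma_{m,k} = 0 for m <= 0, k > 0. *)
Definition residue (p q : nat) : Pol :=
  if (q < d2)%N then shadow_sum M t al be p q else compat_sum M t al be p q.

Lemma compat_sum_recursion (d : int) p q : posp d = d2 -> (p <= M)%N ->
  \sum_(1 <= k < p.+1) - compat_sum M t al be (p - k) q * vsig (d - q%:Z) k al =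
  compat_sum M t al be p q - residue p q.
Proof.
move=> ed le_p; rewrite /residue; case: ltnP => [lt_q|le_q].
  rewrite (sum_recursion (fun k => compat_sum M t al be k q)); last exact: vsig0.
  (* [q < posp d] forces [d] to be positive, so integer and natural subtraction agree. *)
  suff -> : d - q%:Z = (d2 - q)%N%:Z by rewrite compat_sum_vsig.
  by move: ed lt_q; case: d => /= m; lia.
rewrite subrr big_nat big1 // => k hk; rewrite vsig_npos ?mulr0 //; last lia.
by move: ed le_q; case: d => //= m; lia.
Qed.

Lemma nonneg_residue p q : (forall k, nonneg_coefs (al k)) ->
  (forall k, nonneg_coefs (be k)) -> nonneg_coefs (residue p q).
Proof.
move=> al_ge0 be_ge0; rewrite /residue.
by case: ifP => _; apply: nonneg_sum => w _; apply: nonneg_prod => k _; case: (t k).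
Qed.

Lemma compat_sum00 : compat_sum M t al be 0 0 = 1.
Proof.
rewrite /compat_sum (big_pred1 [ffun=> ord0]) => [|w].
  by rewrite /wgt big1 // => k _; rewrite ffunE /= al0 be0; case: (t k).
apply/andP/eqP => [[/andP[_ wN0] wE0]|->].
  move: wN0 wE0; rewrite /sumN /sumE !sum_nat_eq0 => /forallP wN0 /forallP wE0.
  apply/ffunP => k; rewrite ffunE; apply/val_inj/eqP.
  by have := wN0 k; have := wE0 k; case: (t k).
split; last by apply/eqP/big1 => k _; rewrite ffunE.
apply/andP; split; last by apply/eqP/big1 => k _; rewrite ffunE.
apply/forallP => u; apply/forallP => v.
by rewrite !ffunE /= andbF.
Qed.

End Residue.

Section Dichotomy.
Variables (n M : nat) (t t' : 'I_n -> bool) (al be : nat -> Pol) (a b : nat).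
Hypothesis t'E : forall k, t' k = ~~ t (rev_ord k).
Hypotheses (card_a : #|[set k | t k]| = a) (card_b : #|[set k | ~~ t k]| = b).
Hypotheses (slope : slope_le t a b) (slope' : slope_le t' b a).

Lemma card_rev_a : #|[set k | ~~ t' k]| = a.
Proof. by rewrite -card_a; apply: card_rev => k; apply: type_revN. Qed.

Lemma card_rev_b : #|[set k | t' k]| = b.
Proof. by rewrite -card_b; apply: card_rev => k; apply: type_rev. Qed.

(** If [q < b] and [p < a], two nonzero residues would give [p * b < q * a] and its reverse. If just
    one of these holds, the matching slope bound is impossible; if neither does, no compatible
    grading has these totals. *)
Lemma residue_dichotomy p q : (0 < p + q)%N ->
  residue M t al be p q = 0 \/ residue M t' be al q p = 0.
Proof.
move=> pq_gt0; rewrite /residue card_b card_rev_a.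
have bound := @shadow_sum_bound n M t al be; rewrite card_a card_b in bound.
have bound' := @shadow_sum_bound n M t' be al.
rewrite card_rev_a card_rev_b in bound'.
case: (ltnP q b) => hq; case: (ltnP p a) => hp.
- have [->|[|h1]] := bound slope p q hq; [by left | lia |].
  have [->|[|h2]] := bound' slope' q p hp; [by right | lia |].
  by lia.
- by have [->|[|h]] := bound slope p q hq; [left | lia | nia].
- by have [->|[|h]] := bound' slope' q p hp; [right | lia | nia].
- by left; apply: compat_sum_overfull; rewrite ?card_a ?card_b.
Qed.

End Dichotomy.

Lemma cgen00 l1 l2 d1 d2 fuel : cgen l1 l2 d1 d2 fuel 0 0 = 1.
Proof. by case: fuel. Qed.

Lemma cgenS l1 l2 d1 d2 fuel p q : ~~ ((p == 0%N) && (q == 0%N)) ->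
  cgen l1 l2 d1 d2 fuel.+1 p q =
  tmax (\sum_(1 <= k < p.+1) - cgen l1 l2 d1 d2 fuel (p - k) q
                              * vsig (d2 - q%:Z) k (pv l1 1))
       (\sum_(1 <= k < q.+1) - cgen l1 l2 d1 d2 fuel p (q - k)
                              * vsig (d1 - p%:Z) k (pv l2 2)).
Proof. by move=> /negbTE pq_neq0; cbn [cgen]; rewrite pq_neq0. Qed.

Lemma pv0 l i : pv l i 0 = 1.
Proof. by []. Qed.

Lemma compatibleE a b (w : 'I_(a + b) -> nat) :
  compatible w = gcompat (fun k : 'I_(a + b) => isE a b k) w.
Proof.
apply: eq_forallb => u; apply: eq_forallb => v; congr (_ ==> _).
apply/existsP/orP => [[e /andP[arc_e /orP[he|he]]]|].
- by left; apply/existsP; exists e; rewrite arc_e he.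
- by right; apply/existsP; exists e; rewrite arc_e he.
by case=> /existsP[e /andP[arc_e he]]; exists e; rewrite arc_e he ?orbT.
Qed.

(* Gradings take values in N; since omega(P_N) = p and omega(P_E) = q, every
   value is <= p + q, so summing over {ffun edges -> 'I_(p+q).+1} enumerates
   exactly all such gradings. *)
Theorem theorem3p13 (l1 l2 : option nat)
    (hl1 : forall n, l1 = Some n -> (0 < n)%N)
    (hl2 : forall n, l2 = Some n -> (0 < n)%N)
    (d1 d2 : int) (p q : nat) :
  cc l1 l2 d1 d2 p q =
  \sum_(w : {ffun 'I_(posp d1 + posp d2) -> 'I_(p + q).+1}
          | compatible (fun k => nat_of_ord (w k))
            && (wN (fun k => nat_of_ord (w k)) == p)
            && (wE (fun k => nat_of_ord (w k)) == q))
     wt l1 l2 (fun k => nat_of_ord (w k)).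
Proof.
pose a := posp d1; pose b := posp d2; pose M := (p + q)%N.
pose t (k : 'I_(a + b)) := isE a b k; pose t' k := ~~ t (rev_ord k).
pose al := pv l1 1; pose be := pv l2 2.
transitivity (compat_sum M t al be p q); last first.
  by apply: eq_big => [w|//]; rewrite compatibleE.
rewrite /cc.
have [card_a card_b slopes] := dyck_path_slope (erefl (a + b)%N).
have slope : slope_le t a b by move=> u v tu tv; have [] := slopes u v tu tv.
have t'E k : t' k = ~~ t (rev_ord k) by [].
have slope' : slope_le t' b a.
  by apply: (slope_le_rev t'E) => u v tu tv; have [] := slopes u v tu tv.
have al0 : al 0%N = 1 := pv0 l1 1.
have be0 : be 0%N = 1 := pv0 l2 2.
have F00 := @compat_sum00 _ M t _ _ al0 be0.
(* [M] stays fixed while [p'] and [q'] decrease, so all sums of the recursion range over one finite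
   set of gradings. *)
have cgenE fuel p' q' : (p' + q' <= fuel)%N -> (p' + q' <= M)%N ->
    cgen l1 l2 d1 d2 fuel p' q' = compat_sum M t al be p' q'; last first.
  exact: cgenE (leqnn _) (leqnn _).
elim: fuel p' q' => [|fuel IH] p' q' le_fuel le_M.
  by have [-> ->] : p' = 0%N /\ q' = 0%N by lia; rewrite cgen00 F00.
have [/andP[/eqP -> /eqP ->]|pq_neq0] := boolP ((p' == 0%N) && (q' == 0%N)).
  by rewrite cgen00 F00.
have recN : \sum_(1 <= k < p'.+1) - compat_sum M t al be (p' - k) q' *
    vsig (d2 - q'%:Z) k al = compat_sum M t al be p' q' - residue M t al be p' q'.
  have cardN : posp d2 = #|[set k | ~~ t k]| by rewrite card_b.
  by apply: (compat_sum_recursion be al0 q' cardN); lia.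
have recE : \sum_(1 <= k < q'.+1) - compat_sum M t al be p' (q' - k) *
    vsig (d1 - p'%:Z) k be = compat_sum M t al be p' q' - residue M t' be al q' p'.
  (* The second sum is the first one of the reflected path, with [p'] and [q'] exchanged. *)
  rewrite -(compat_sum_rev t'E M al be p' q').
  have cardE : posp d1 = #|[set k | ~~ t' k]| by rewrite (card_rev_a t'E card_a).
  rewrite -(compat_sum_recursion al be0 p' cardE); last lia.
  by apply: eq_bigr => k _; rewrite (compat_sum_rev t'E).
rewrite (cgenS _ _ _ _ _ pq_neq0) -/al -/be.
have -> : \sum_(1 <= k < p'.+1) - cgen l1 l2 d1 d2 fuel (p' - k) q' *
    vsig (d2 - q'%:Z) k al = compat_sum M t al be p' q' - residue M t al be p' q'.
  apply: etrans recN; apply: eq_big_nat => k hk.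
  by rewrite IH //; lia.
have -> : \sum_(1 <= k < q'.+1) - cgen l1 l2 d1 d2 fuel p' (q' - k) *
    vsig (d1 - p'%:Z) k be = compat_sum M t al be p' q' - residue M t' be al q' p'.
  apply: etrans recE; apply: eq_big_nat => k hk.
  by rewrite IH //; lia.
apply: tmax_dichotomy.
- by apply: nonneg_residue => k; apply: nonneg_pv.
- by apply: nonneg_residue => k; apply: nonneg_pv.
- by apply: (residue_dichotomy M al be t'E card_a card_b slope slope'); lia.
Qed.
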